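(* Let $H$ be a complex Hilbert space and let $A$ and $B$ be two linear operators in $H$ such that $A$ is closed (possibly unbounded, with domain $D(A)$) and $B\in B(H)$. (1) If $BA$ is positive (i.e. $\langle BAx,x\rangle\geq 0$ for all $x\in D(BA)$) and invertible, then $|A|^2+|B^*|^2$ is invertible. Besides, \[\langle(|A|^2+|B^*|^2)^{-1}x,x\rangle\leq \langle(BA)^{-1}x,x\rangle\quad\text{for all } x\in H.\] (2) If $AB$ is densely defined, positive (i.e. $\langle ABx,x\rangle\geq 0$ for all $x\in D(AB)$) and invertible, then $|A^*|^2+|B|^2$ is invertible. Moreover, \[\langle(|A^*|^2+|B|^2)^{-1}x,x\rangle\leq \langle(AB)^{-1}x,x\rangle\quad\text{for all } x\in H.\]
   Context: $B(H)$ denotes the algebra of all bounded linear operators on $H$. Products and sums of operators have their natural domains: $D(BA)=D(A)$, $D(AB)=\{x\in H: Bx\in D(A)\}$, and $D(S+T)=D(S)\cap D(T)$. $T^*$ denotes the adjoint of $T$ and $|T|=\sqrt{T^*T}$ its absolute value, so that $|A|^2=A^*A$, $|A^*|^2=AA^*$, $|B|^2=B^*B$ and $|B^*|^2=BB^*$. A possibly unbounded operator $T$ is invertible (boundedly invertible) if it is a bijection from $D(T)$ onto $H$ whose inverse $T^{-1}$ belongs to $B(H)$. *)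

(* Defs.v *)
From HB Require Import structures.
From mathcomp Require Import all_boot all_order all_algebra.
From mathcomp Require Import sesquilinear complex.
From mathcomp Require Import boolp classical_sets reals topology normedtype.

Set Implicit Arguments.
Unset Strict Implicit.
Unset Printing Implicit Defensive.

Import Order.TTheory GRing.Theory Num.Theory.
Import numFieldNormedType.Exports.

Local Open Scope classical_set_scope.
Local Open Scope complex_scope.
Local Open Scope ring_scope.

(* A complex Hilbert space is a complete normed space [H] over [R[i]] together
   with an inner product [dot : {dot H for Num.conj}], linear in its first
   argument, that induces the norm. *)
Definition induces_norm (R : realType) (H : completeNormedModType R[i])
  (dot : {dot H for Num.conj}) : Prop := forall x : H, `|x| ^+ 2 = dot x x.

Section Operators.
Context {R : realType} {H : completeNormedModType R[i]}.
Implicit Types (S T : set (H * H)) (B : H -> H).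

(* Operators are identified with their graphs: [T (x, y)] means that x is in
   D(T) and T x = y.  Sets of pairs that need not be graphs of functions are
   allowed, because the adjoint of an operator whose domain is not dense is
   only a linear relation. *)
Definition is_operator T : Prop :=
  [/\ T (0, 0),
      forall (a : R[i]) x y x' y',
        T (x, y) -> T (x', y') -> T (a *: x + x', a *: y + y') &
      forall x y y', T (x, y) -> T (x, y') -> y = y'].

Definition op_dom T : set H := [set x | exists y, T (x, y)].

Definition op_graph B : set (H * H) := [set p | p.2 = B p.1].

Definition op_mul S T : set (H * H) :=
  [set p | exists2 z, T (p.1, z) & S (z, p.2)].

Definition op_add S T : set (H * H) :=
  [set p | exists y z, [/\ S (p.1, y), T (p.1, z) & p.2 = y + z]].

Definition densely_defined T : Prop := dense (op_dom T).

(* B(H): [bounded_near B (nbhs 0)] is operator boundedness for a linear [B],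
   see [linear_boundedP]. *)
Definition bounded_operator (B : {linear H -> H}) : Prop :=
  bounded_near B (nbhs (0 : H)).

Definition invertible_op T : Prop :=
  is_operator T /\
  exists2 S : {linear H -> H},
    bounded_operator S & forall x y, T (x, y) <-> x = S y.

(* The everywhere defined inverse; meaningful when [invertible_op T] holds. *)
Definition op_inv T : H -> H := fun y => xget 0 [set x | T (x, y)].

Variable dot : {dot H for Num.conj}.

(* On [R[i]], [0 <= z] says that z is real and nonnegative. *)
Definition positive_op T : Prop := forall x y, T (x, y) -> 0 <= dot y x.

(* [op_adj T (u, v)] iff <T x, u> = <x, v> for all x in D(T).  This is the
   graph of the usual adjoint when D(T) is dense. *)
Definition op_adj T : set (H * H) :=
  [set p | forall x y, T (x, y) -> dot y p.1 = dot x p.2].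

(* |T|^2 = T^* T; for closed T one has T^** = T, so that |T^*|^2 = T T^*. *)
Definition sqr_abs T : set (H * H) := op_mul (op_adj T) T.

End Operators.

(* Main.v *)
Require Import Defs.
From HB Require Import structures.
From mathcomp Require Import all_boot all_order all_algebra.
From mathcomp Require Import sesquilinear complex.
From mathcomp Require Import boolp classical_sets reals topology normedtype.
From mathcomp Require Import interval_inference ring lra.

Set Implicit Arguments.
Unset Strict Implicit.
Unset Printing Implicit Defensive.

Import Order.TTheory GRing.Theory Num.Theory.
Import numFieldNormedType.Exports.

Local Open Scope classical_set_scope.
Local Open Scope complex_scope.
Local Open Scope ring_scope.

(* Both parts are instances of one fact about a closed linear relation T with
   dense domain and bounded operators C and S >= 0 such that x = S C^* v
   whenever (x, v) is in T: take (T, C, S) = (A, B^*, (BA)^-1) for (1) and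
   (A^*, B, (AB)^-1) for (2).  With t = C^* v, so that x = S t,
     <S t, t> = Re <C x, v> <= (|v|^2 + |C x|^2) / 2,
   and |S t|^2 <= k <S t, t> shows that the closed form |v|^2 + |C x|^2 on T is
   coercive.  Minimizing it minus 2 Re <x, y> over T solves
   (T^*T + C^*C) x = y.  For this solution <x, y> = |v|^2 + |C x|^2, and the
   Cauchy-Schwarz inequality for S gives
   <x, y>^2 = <S t, y>^2 <= <S t, t> <S y, y> <= <x, y> <S y, y> / 2. *)

(** * Real inequalities for quadratic expressions *)

Lemma discriminant_le (R : realFieldType) (a b c : R) : 0 <= c ->
  (forall t, 0 <= a + 2 * t * b + t ^+ 2 * c) -> b ^+ 2 <= a * c.
Proof.
rewrite le_eqVlt => /predU1P[<- h|c0 /(_ (- b / c))].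
  rewrite mulr0; have [->|b0] := eqVneq b 0; first by rewrite expr0n.
  (* With [c = 0] the function is affine: it takes the value [a] at 0 and [- a - 2] here, and these
     cannot both be nonnegative. *)
  have := h (- (a + 1) / b).
  have -> : a + 2 * (- (a + 1) / b) * b + (- (a + 1) / b) ^+ 2 * 0 = - a - 2.
    by field.
  have := h 0; lra.
have -> : a + 2 * (- b / c) * b + (- b / c) ^+ 2 * c = (a * c - b ^+ 2) / c.
  by field; rewrite gt_eqF.
by rewrite pmulr_lge0 ?invr_gt0// subr_ge0.
Qed.

(** AM-GM bounds the cross term [2 * b] by [a + c]. *)
Lemma perturbation_le (R : realFieldType) (a b c : R) :
  0 <= a -> 0 <= c -> b ^+ 2 <= a * c ->
  a + 2 * b + c <= 2 * (a + c).
Proof.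
move=> a0 c0 h; suff : 2 * b <= a + c by lra.
rewrite leNgt; apply/negP => ba.
have : 0 < (2 * b - (a + c)) * (2 * b + (a + c)) by apply: mulr_gt0; lra.
have := sqr_ge0 (a - c); nra.
Qed.

Lemma le0_small (R : realFieldType) (r M : R) :
  0 <= M -> (forall e, 0 < e -> r <= M * e) -> r <= 0.
Proof.
move=> M0 h; rewrite leNgt; apply/negP => r0.
have M1 : 0 < M + 1 by lra.
have := h _ (divr_gt0 r0 M1); rewrite mulrA ler_pdivlMr//; nra.
Qed.

(** * Real part of the inner product and squared norm *)

Section InnerProduct.
Context {R : realType} {H : completeNormedModType R[i]}.
Variable dot : {dot H for Num.conj}.

(** Estimates then take place in [R]; imaginary parts are recovered by replacing [x] with ['i *: x],
    as in [dot_eq_re]. *)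
Definition redot (x y : H) : R := complex.Re (dot x y).

Definition sqnorm (x : H) : R := redot x x.

Lemma dotC x y : dot y x = (dot x y)^*.
Proof. by rewrite (hermC dot y x)/= expr0 mul1r. Qed.

Lemma redotC x y : redot x y = redot y x.
Proof. by rewrite /redot dotC; case: (dot y x). Qed.

Lemma redotDl x y z : redot (x + y) z = redot x z + redot y z.
Proof. by rewrite /redot linearDl/=; case: (dot x z) (dot y z) => [a b] []. Qed.

Lemma redotZl (t : R) x y : redot (t%:C *: x) y = t * redot x y.
Proof. by rewrite /redot linearZl_LR/=; case: (dot x y) => a b /=; ring. Qed.

Lemma redotil x y : redot ('i *: x) y = - complex.Im (dot x y).
Proof. by rewrite /redot linearZl_LR/= mulrC ReiNIm. Qed.

Lemma redotDr x y z : redot z (x + y) = redot z x + redot z y.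
Proof. by rewrite redotC redotDl !(redotC z). Qed.

Lemma redotZr (t : R) x y : redot x (t%:C *: y) = t * redot x y.
Proof. by rewrite redotC redotZl redotC. Qed.

Lemma redotNl x y : redot (- x) y = - redot x y.
Proof. by rewrite /redot linearNl/=; case: (dot x y). Qed.

Lemma redotii x y : redot ('i *: x) ('i *: y) = redot x y.
Proof.
rewrite /redot linearZl_LR linearZr_LR/= mulrA.
suff -> : 'i * Num.conj 'i = 1 :> R[i] by rewrite mul1r.
by rewrite -normCK normc_def/= expr0n expr1n add0r sqrtr1 expr1n.
Qed.

Lemma redotNr x y : redot x (- y) = - redot x y.
Proof. by rewrite redotC redotNl redotC. Qed.

Lemma dot0l x : dot 0 x = 0. Proof. by rewrite linear0l. Qed.

Lemma dotE x : dot x x = (sqnorm x)%:C.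
Proof.
rewrite /sqnorm /redot; have := dotC x x.
by case: (dot x x) => a b [] e; congr (_ +i* _); lra.
Qed.

Lemma sqnorm_eq0 x : sqnorm x <= 0 -> x = 0.
Proof.
move=> h; apply/eqP/negP => /negP /(neq0_dnorm_gt0 (s := dot)).
by rewrite dotE ltcR; lra.
Qed.

Lemma sqnorm_ge0 x : 0 <= sqnorm x.
Proof.
have [->|/(neq0_dnorm_gt0 (s := dot))] := eqVneq x 0.
  by rewrite /sqnorm /redot dot0l.
by rewrite dotE ltcR => /ltW.
Qed.

Lemma sqnormDZ x y (t : R) :
  sqnorm (x + t%:C *: y) = sqnorm x + 2 * t * redot x y + t ^+ 2 * sqnorm y.
Proof.
rewrite /sqnorm !redotDl !redotDr !redotZl !redotZr (redotC y x); ring.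
Qed.

Lemma sqnormD x y : sqnorm (x + y) = sqnorm x + 2 * redot x y + sqnorm y.
Proof. rewrite /sqnorm !redotDl !redotDr (redotC y x); ring. Qed.

Lemma sqnormB x y : sqnorm (x - y) = sqnorm x - 2 * redot x y + sqnorm y.
Proof.
rewrite /sqnorm !redotDl !redotDr !redotNl !redotNr (redotC y x); ring.
Qed.

Lemma redot_CS x y : redot x y ^+ 2 <= sqnorm x * sqnorm y.
Proof. by apply: discriminant_le => [|t]; rewrite -?sqnormDZ sqnorm_ge0. Qed.

Lemma sqnormBC x y : sqnorm (x - y) = sqnorm (y - x).
Proof. by rewrite !sqnormB (redotC x); lra. Qed.

Lemma dot_eq_re (x x' y y' : H) : redot x y = redot x' y' ->
  redot ('i *: x) y = redot ('i *: x') y' -> dot x y = dot x' y'.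
Proof.
rewrite !redotil /redot; case: (dot x y) (dot x' y') => [a b] [c d] /= -> e.
by congr (_ +i* _); lra.
Qed.

(** * Boundedness, completeness and closedness in terms of the squared norm *)

Hypothesis hdot : induces_norm dot.

Lemma norm_lt_sqnorm x (e : R) : 0 < e -> (`|x| < e%:C) = (sqnorm x < e ^+ 2).
Proof.
move=> e0; rewrite -(ltr_pXn2r (n := 2))// ?nnegrE ?lecR ?(ltW e0)//.
by rewrite hdot dotE -rmorphXn/= ltcR.
Qed.

Lemma norm_le_sqnorm x y (k : R) : 0 <= k ->
  (`|x| <= k%:C * `|y|) = (sqnorm x <= k ^+ 2 * sqnorm y).
Proof.
move=> k0; rewrite -(ler_pXn2r (n := 2))// ?nnegrE ?mulr_ge0 ?ler0c//.
by rewrite exprMn !hdot !dotE -rmorphXn/= -rmorphM/= lecR.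
Qed.

Definition sqnorm_bounded (f : H -> H) :=
  exists2 K : R, 0 < K & forall x, sqnorm (f x) <= K * sqnorm x.

Lemma bounded_operatorP (f : {linear H -> H}) :
  bounded_operator f <-> sqnorm_bounded f.
Proof.
rewrite /bounded_operator linear_boundedP; split.
  move=> /pinfty_ex_gt0 [r r0 h]; have rR : r = (complex.Re r)%:C.
    by rewrite RRe_real// gtr0_real.
  exists (complex.Re r ^+ 2); first by rewrite exprn_gt0// -ltcR -rR.
  by move=> x; rewrite -norm_le_sqnorm -?rR// -lecR -rR ltW.
(* [K + 1] avoids a square root, since [K <= (K + 1) ^+ 2]. *)
move=> [K K0 h]; exists ((K + 1)%:C); split; first by rewrite complex_real.
move=> r hr x; apply: (@le_trans _ _ ((K + 1)%:C * `|x|)).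
  rewrite norm_le_sqnorm; last by lra.
  by apply: (le_trans (h x)); rewrite ler_wpM2r ?sqnorm_ge0//; nra.
by rewrite ler_wpM2r// ltW.
Qed.

Lemma sqnorm_complete (u : nat -> H) :
  (forall e, 0 < e -> exists N, forall n m, (N <= n)%N -> (N <= m)%N ->
    sqnorm (u n - u m) < e) ->
  exists x, forall e, 0 < e -> exists N, forall n, (N <= n)%N ->
    sqnorm (u n - x) < e.
Proof.
move=> h; have : cauchy (u @ \oo).
  apply: cauchy_exP => e e0; have eR : e = (complex.Re e)%:C.
    by rewrite RRe_real// gtr0_real.
  have e1 : 0 < complex.Re e by rewrite -ltcR -eR.
  have [|N hN] := h (complex.Re e ^+ 2); first by rewrite exprn_gt0.
  exists (u N); exists N => // n /= Nn; rewrite -ball_normE /ball_ /= eR.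
  by rewrite norm_lt_sqnorm// hN.
move=> /cauchy_cvg/cvg_ex [x /cvgrPdist_lt hx]; exists x => e e0.
have s0 : 0 < Num.sqrt e by rewrite sqrtr_gt0.
have [|N _ hN] := hx (Num.sqrt e)%:C; first by rewrite ltcR.
exists N => n /hN; rewrite distrC norm_lt_sqnorm// sqr_sqrtr// ltW//.
Qed.

(** Closedness is stated by approximation so that it can be checked by estimates, for instance for
    adjoints and inverted graphs. *)
Definition sqnorm_closed (G : set (H * H)) : Prop := forall x y,
  (forall e : R, 0 < e ->
    exists p, [/\ G p, sqnorm (p.1 - x) < e & sqnorm (p.2 - y) < e]) ->
  G (x, y).

Lemma closed_sqnorm_closed (G : set (H * H)) : closed G -> sqnorm_closed G.
Proof.
move=> cG x y h; apply: cG => V /nbhs_ballP [e e0 hV].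
have eR : e = (complex.Re e)%:C.
  by rewrite RRe_real// gtr0_real.
have e1 : 0 < complex.Re e by rewrite -ltcR -eR.
have [|p [Gp p1 p2]] := h (complex.Re e ^+ 2); first by rewrite exprn_gt0.
exists p; split=> //; apply: hV; split=> /=;
  by rewrite -ball_normE /ball_ /= eR distrC norm_lt_sqnorm.
Qed.

(** Uniqueness of values is left out because [op_adj dot A] must be covered as well. *)
Definition linear_relation (G : set (H * H)) : Prop :=
  G (0, 0) /\ forall (a : R[i]) x v x' v',
    G (x, v) -> G (x', v') -> G (a *: x + x', a *: v + v').

Lemma linear_relationDZ G (a : R[i]) x v x' v' : linear_relation G ->
  G (x, v) -> G (x', v') -> G (x + a *: x', v + a *: v').
Proof. by move=> [_ h] g g'; rewrite addrC [v + _]addrC; apply: h. Qed.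

Lemma linear_relationZ G (a : R[i]) x v : linear_relation G ->
  G (x, v) -> G (a *: x, a *: v).
Proof. by move=> [G0 h] g; have := h a _ _ _ _ g G0; rewrite !addr0. Qed.

Lemma linear_relationB G x v x' v' : linear_relation G ->
  G (x, v) -> G (x', v') -> G (x - x', v - v').
Proof.
move=> lG g g'; rewrite -(scaleN1r x') -(scaleN1r v').
exact: linear_relationDZ.
Qed.

(** * Minimizing a coercive quadratic functional over a closed linear relation *)

Section Riesz.
Variables (G : set (H * H)) (C : {linear H -> H}) (c : R).
Hypothesis lG : linear_relation G.
Hypothesis cG : sqnorm_closed G.
Hypothesis bC : sqnorm_bounded C.

Definition energy (x v : H) : R := sqnorm v + sqnorm (C x).

Hypothesis c0 : 0 < c.
Hypothesis coercive : forall x v, G (x, v) -> sqnorm x <= c * energy x v.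
Variable y : H.

Let J x v := energy x v - 2 * redot x y.

(** Half the derivative of [J] at [(x, v)] in the direction [(x', v')]. *)
Let slope x v x' v' := redot v v' + redot (C x) (C x') - redot x' y.

Lemma energy_ge0 x v : 0 <= energy x v.
Proof. by rewrite addr_ge0 ?sqnorm_ge0. Qed.

Lemma functionalDZ x v x' v' (t : R) : J (x + t%:C *: x') (v + t%:C *: v') =
  J x v + 2 * t * slope x v x' v' + t ^+ 2 * energy x' v'.
Proof.
rewrite /J /energy /slope linearD linearZ/= !sqnormDZ redotDl redotZl; ring.
Qed.

Lemma functionalB x v x' v' :
  J x' v' = J x v + 2 * slope x v (x' - x) (v' - v) + energy (x' - x) (v' - v).
Proof.
have := functionalDZ x v (x' - x) (v' - v) 1.
by rewrite !scale1r !subrKC => ->; rewrite mulr1 expr1n mul1r.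
Qed.

(** Expanding the squared norm of [x - c y] bounds [2 * redot x y] by [sqnorm x / c + c * sqnorm y];
    coercivity absorbs the first term into the energy. *)
Lemma functional_ge x v : G (x, v) -> - (c * sqnorm y) <= J x v.
Proof.
move=> /coercive h; have := sqnorm_ge0 (x + (- c)%:C *: y).
rewrite sqnormDZ /J => h'.
suff : 0 <= c * (c * sqnorm y + energy x v - 2 * redot x y).
  rewrite pmulr_rge0//; lra.
nra.
Qed.

Let values := [set r | exists2 p, G p & r = J p.1 p.2].

Let has_inf_values : has_inf values.
Proof.
split; first by exists (J 0 0); exists (0, 0) => //; case: lG.
by exists (- (c * sqnorm y)) => _ [[x v] g ->]; exact: functional_ge.
Qed.

Let m := inf values.

Lemma inf_functional_le x v : G (x, v) -> m <= J x v.
Proof.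
move=> g; apply: ge_inf; first by case: has_inf_values.
by exists (x, v).
Qed.

(** Along a line in [G], [J - m] is a nonnegative quadratic polynomial in [t], and this is its
    discriminant bound. At a minimizer it forces the slope to vanish. *)
Lemma slope_sqr_le x v x' v' : G (x, v) -> G (x', v') ->
  slope x v x' v' ^+ 2 <= (J x v - m) * energy x' v'.
Proof.
move=> g g'; apply: discriminant_le => [|t]; first exact: energy_ge0.
have := inf_functional_le (linear_relationDZ t%:C lG g g').
rewrite functionalDZ; lra.
Qed.

(** This lets the excess of [J] over [m] pass to the limit of a minimizing sequence: the slope term
    is absorbed by AM-GM. *)
Lemma functional_le x v x' v' : G (x, v) -> G (x', v') ->
  J x' v' - m <= 2 * (J x v - m + energy (x' - x) (v' - v)).
Proof.
move=> g g'.
rewrite (functionalB x v).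
have := perturbation_le _ _ (slope_sqr_le g (linear_relationB lG g' g)).
rewrite subr_ge0 inf_functional_le// energy_ge0 => /(_ isT isT); lra.
Qed.

(* The parallelogram identity at the midpoint. *)
Lemma energyB_le x v x' v' : G (x, v) -> G (x', v') ->
  energy (x' - x) (v' - v) <= 2 * (J x v - m + (J x' v' - m)).
Proof.
move=> g g'.
have gd := linear_relationB lG g' g.
have := inf_functional_le (linear_relationDZ (2^-1)%:C lG g gd).
rewrite functionalDZ (functionalB x v x' v'); lra.
Qed.

(** A minimizing sequence is Cauchy in energy by [energyB_le]. The energy dominates the squared norm
    of the second components directly and that of the first ones by coercivity, so both converge,
    and [G] is closed. *)
Lemma functional_minimizer : exists2 p, G p & J p.1 p.2 <= m.
Proof.
have /choice[u hu] : forall n : nat, exists p,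
    G p /\ J p.1 p.2 < m + n.+1%:R^-1.
  move=> n.
  have [|_ [p g ->] h] := inf_adherent _ has_inf_values (eps := n.+1%:R^-1).
    by rewrite invr_gt0 ltr0n.
  by exists p.
have gu n : G ((u n).1, (u n).2) by rewrite -surjective_pairing; case: (hu n).
have Ju (e : R) : 0 < e -> exists N, forall n, (N <= n)%N ->
    J (u n).1 (u n).2 - m < e.
  move=> e0; have [N _ hN] := near_infty_natSinv_lt (PosNum e0).
  exists N => n /hN /= ne; rewrite ltrBlDl (lt_le_trans (hu n).2)//.
  by rewrite lerD2l ltW.
have Eu (e : R) : 0 < e -> exists N, forall n k, (N <= n)%N -> (N <= k)%N ->
    energy ((u n).1 - (u k).1) ((u n).2 - (u k).2) < e.
  move=> e0; have [|N hN] := Ju (e / 4); first by rewrite divr_gt0.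
  exists N => n k /hN hn /hN hk; have := energyB_le (gu k) (gu n).
  lra.
have [|x hx] := sqnorm_complete (u := fun n => (u n).1).
  move=> e e0; have [|N hN] := Eu (e / c); first by rewrite divr_gt0.
  exists N => n k Nn Nk; apply: le_lt_trans (coercive _) _.
    by apply: (linear_relationB lG); exact: gu.
  by rewrite mulrC -ltr_pdivlMr// hN.
have [|v hv] := sqnorm_complete (u := fun n => (u n).2).
  move=> e e0; have [|N hN] := Eu e; first by [].
  exists N => n k Nn Nk; apply: le_lt_trans (hN n k Nn Nk).
  by rewrite lerDl sqnorm_ge0.
have Gxv : G (x, v).
  apply: cG => e e0.
  have [[N hN] [M hM]] := (hx e e0, hv e e0).
  exists (u (maxn N M)); split; rewrite ?hN ?hM ?leq_maxl ?leq_maxr//.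
  by case: (hu (maxn N M)).
exists (x, v) => //=; apply/ler_addgt0Pr => e e0.
have [K K0 hK] := bC.
(* If both components of a difference have squared norm below this number, its energy is at most
   [e / 4]; then [functional_le] gives [2 * (e / 4 + e / 4) = e]. *)
have d0 : 0 < e / 4 / (1 + K) by rewrite !divr_gt0// addr_gt0.
have e4 : 0 < e / 4 by rewrite divr_gt0.
have [[[N hN] [M hM]] [P hP]] := (hx _ d0, hv _ d0, Ju _ e4).
pose n := maxn N (maxn M P).
have := functional_le (gu n) Gxv.
have : J (u n).1 (u n).2 - m < e / 4.
  by apply: hP; rewrite /n !leq_max leqnn !orbT.
suff : energy (x - (u n).1) (v - (u n).2) <= e / 4 by lra.
rewrite /energy; apply: (@le_trans _ _ ((1 + K) * (e / 4 / (1 + K)))); last first.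
  by rewrite mulrC divfK// gt_eqF// addr_gt0.
rewrite mulrDl mul1r; apply: lerD.
  by rewrite ltW// sqnormBC hM// /n !leq_max leqnn !orbT.
apply: (le_trans (hK _)); rewrite ler_pM2l// ltW// sqnormBC hN//.
by rewrite /n leq_max leqnn.
Qed.

(** The Euler-Lagrange equation of the minimizer; the direction multiplied by ['i] supplies the
    imaginary part. *)
Lemma riesz_energy : exists2 q, G q & forall p, G p ->
  dot p.2 q.2 + dot (C p.1) (C q.1) = dot p.1 y.
Proof.
have [[x v] g le_m] := functional_minimizer; exists (x, v) => //= -[x' v'] /= g'.
have slope0 z w : G (z, w) -> slope x v z w = 0.
  move=> gz; apply/eqP; rewrite -sqrf_eq0 eq_le sqr_ge0 andbT//.
  apply: (le_trans (slope_sqr_le g gz)).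
  by rewrite mulr_le0_ge0 ?energy_ge0// subr_le0.
have slopeE z w : G (z, w) -> redot w v + redot (C z) (C x) = redot z y.
  by move=> /slope0; rewrite /slope (redotC v) (redotC (C x)); lra.
have := slopeE _ _ (linear_relationZ 'i lG g').
have := slopeE _ _ g'; rewrite linearZ/= !redotil /redot.
case: (dot v' v) (dot (C x') (C x)) (dot x' y) => [a b] [a' b'] [a'' b''] /= e e'.
by congr (_ +i* _); lra.
Qed.

End Riesz.

(** * Adjoints of bounded operators and of relations *)

Lemma sqnormD_le x y : sqnorm (x + y) <= 2 * (sqnorm x + sqnorm y).
Proof. by have := sqnorm_ge0 (x - y); rewrite sqnormB sqnormD; lra. Qed.

Lemma dot_ext x y : (forall z, dot z x = dot z y) -> x = y.
Proof.
move=> h; apply/eqP; rewrite -subr_eq0; apply/eqP; apply: sqnorm_eq0.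
by rewrite /sqnorm /redot linearBr/= h subrr.
Qed.

Definition linear_map (f : H -> H) (lf : linear f) : {linear H -> H} :=
  HB.pack f (GRing.isLinear.Build _ _ _ _ f lf).

(** [riesz_energy] is applied to the inverted graph of [B] with [C = 0]. The energy of [(B v, v)] is
    [sqnorm v], so coercivity is the boundedness of [B], and the equation solved reads
    [dot v d = dot (B v) y]. *)
Lemma adjoint_exists (B : {linear H -> H}) : sqnorm_bounded B ->
  exists2 D : {linear H -> H}, sqnorm_bounded D &
    forall x y, dot (B x) y = dot x (D y).
Proof.
move=> [K K0 hK].
have lG : linear_relation [set p | p.1 = B p.2].
  split=> /= [|a x v x' v' -> ->]; first by rewrite linear0.
  by rewrite linearP.
have cG : sqnorm_closed [set p | p.1 = B p.2].
  move=> z x h /=; apply/eqP; rewrite -subr_eq0; apply/eqP; apply: sqnorm_eq0.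
  apply: (@le0_small _ _ (2 * (1 + K))); first by nra.
  move=> e /h [[z' x'] /= [-> h1 h2]].
  have -> : z - B x = (z - B x') + B (x' - x) by rewrite linearB/= subrKA.
  apply: (le_trans (sqnormD_le _ _)); rewrite sqnormBC.
  by have := hK (x' - x); nra.
have b0 : sqnorm_bounded (\0 : {linear H -> H}).
  exists 1 => // x; rewrite mul1r; apply: le_trans (sqnorm_ge0 x).
  by rewrite /sqnorm /redot /= linear0l.
have co x v : [set p | p.1 = B p.2] (x, v) ->
    sqnorm x <= K * energy (\0 : {linear H -> H}) x v.
  move=> /= ->; apply: (le_trans (hK v)).
  by rewrite ler_pM2l// /energy lerDl sqnorm_ge0.
have /choice[D hD] : forall y, exists d, forall x, dot (B x) y = dot x d.
  move=> y; have [[z d] _ hd] := riesz_energy lG cG b0 K0 co y.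
  by exists d => x; have := hd (B x, x) erefl; rewrite /= linear0l addr0.
have lD : linear D.
  move=> a u v; apply: dot_ext => z.
  by rewrite linearDr linearZr_LR/= -!hD linearDr linearZr_LR.
exists (linear_map lD) => //=; exists K => // y.
(* Cauchy-Schwarz for [sqnorm (D y) = redot (B (D y)) y] leaves a factor [sqnorm (D y)] to cancel,
   hence the case split. *)
have [->|/eqP nz] := eqVneq (D y) 0.
  rewrite {1}/sqnorm /redot linear0l/= mulr_ge0 ?sqnorm_ge0 ?ltW//.
have := redot_CS (B (D y)) y; rewrite {1}/redot hD -/(redot _ _) -/(sqnorm _).
have Dy0 : 0 < sqnorm (D y).
  by rewrite ltNge; apply/negP => /sqnorm_eq0.
have := hK (D y); have := sqnorm_ge0 y; nra.
Qed.

Lemma op_adj_graph (C D : H -> H) : (forall x y, dot (C x) y = dot x (D y)) ->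
  op_adj dot (op_graph C) = op_graph D.
Proof.
move=> adj; apply/seteqP; split=> -[u v] /= h.
  apply/esym/dot_ext => x; rewrite -adj; exact: (h x (C x)).
by move=> x y; rewrite /op_graph/= in h * => ->; rewrite h adj.
Qed.

Lemma op_adj_linear_relation (T : set (H * H)) : linear_relation (op_adj dot T).
Proof.
split=> [x y _|a x v x' v' h h' z w Tzw] /=; first by rewrite !linear0r.
by rewrite !linearDr !linearZr_LR/= (h z w)// (h' z w).
Qed.

(** By Cauchy-Schwarz both sides of the identity defining the adjoint are continuous in [(u, w)]. *)
Lemma op_adj_sqnorm_closed (T : set (H * H)) : sqnorm_closed (op_adj dot T).
Proof.
move=> u w h x y Txy /=.
(* [a = 1] gives the real parts, [a = 'i] the imaginary parts. *)
suff re (a : R[i]) : redot (a *: y) u = redot (a *: x) w.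
  by apply: dot_eq_re; rewrite ?re//; have := re 1; rewrite !scale1r.
set s := a *: y; set z := a *: x.
apply/eqP; rewrite -subr_eq0 -sqrf_eq0 eq_le sqr_ge0 andbT.
apply: (@le0_small _ _ (2 * (sqnorm s + sqnorm z))).
  by have := sqnorm_ge0 s; have := sqnorm_ge0 z; lra.
move=> e e0; have [[u' w'] [/= hT hu hw]] := h e e0.
have -> : redot s u - redot z w = redot s (u - u') - redot z (w - w').
  rewrite !redotDr !redotNr.
  have -> : redot s u' = redot z w'.
    by rewrite /redot !linearZl_LR/= (hT x y Txy).
  ring.
have := redot_CS s (u - u'); have := redot_CS z (w - w').
rewrite sqnormBC (sqnormBC u).
set b := redot s _; set d := redot z _.
have := sqr_ge0 (b + d); have := sqnorm_ge0 s; have := sqnorm_ge0 z; nra.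
Qed.

(* If [(x, v)] is the point of [A] nearest to [(0, w)], then [(w - v, x)] lies
   in [op_adj dot A], and orthogonality of [w] to its domain forces x = 0 and
   v = w. *)
Lemma op_adj_dense (A : set (H * H)) : is_operator A -> sqnorm_closed A ->
  forall w, (forall x v, op_adj dot A (x, v) -> dot x w = 0) -> w = 0.
Proof.
move=> [A0 linA unA] cA w hw.
(* Inverting the graph pairs [w] with the values of [A] in the functional; with [C] the identity the
   energy is the squared graph norm. *)
have lG : linear_relation [set p | A (p.2, p.1)].
  by split=> //= a x v x' v'; exact: linA.
have cG : sqnorm_closed [set p | A (p.2, p.1)].
  by move=> x v h; apply: cA => e /h[[x' v'] /= [g h1 h2]]; exists (v', x').
have bI : sqnorm_bounded (idfun : {linear H -> H}).
  by exists 1 => // x; rewrite mul1r.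
have co x v : [set p | A (p.2, p.1)] (x, v) ->
    sqnorm x <= 1 * energy (idfun : {linear H -> H}) x v.
  by move=> _; rewrite mul1r /energy lerDr sqnorm_ge0.
have [[v x] /= Axv h] := riesz_energy lG cG bI ltr01 co w.
have adj : op_adj dot A (w - v, x).
  move=> z s Azs /=; rewrite linearBr/= -(h (s, z) Azs)/=; ring.
have := hw _ _ adj; have := adj _ _ Axv; rewrite /= => e1 e2.
have wv : w - v = 0.
  apply: sqnorm_eq0; rewrite {1}/sqnorm redotDr redotNr {1}/redot e2 /=.
  by rewrite redotC /redot e1 -/(sqnorm x) sub0r oppr_le0 sqnorm_ge0.
have x0 : x = 0 by apply: sqnorm_eq0; rewrite /sqnorm /redot -e1 wv linear0r.
have -> : w = v by apply/eqP; rewrite -subr_eq0 wv.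
by apply: (unA 0) => //; rewrite -x0.
Qed.

(** * Bounded positive operators *)

Section PositiveOperator.
Variable S : {linear H -> H}.
Hypothesis bS : sqnorm_bounded S.
Hypothesis posS : forall y, 0 <= dot y (S y).

Lemma positive_redot_ge0 y : 0 <= redot y (S y).
Proof. by have := posS y; rewrite lecE => /andP[]. Qed.

(** Polarization: [dot z (S z)] is real at [a], ['i *: b] and [a + 'i *: b], so the cross terms
    cancel. *)
Lemma positive_symmetric x y : dot (S x) y = dot x (S y).
Proof.
have re a b : redot (S a) b = redot a (S b).
  have im z : redot ('i *: z) (S z) = 0 by rewrite redotil ger0_Im ?oppr0.
  have := im (a + 'i *: b); have := im a; have := im ('i *: b).
  rewrite linearD scalerDr redotDl !redotDr => -> ->.
  rewrite linearZ redotii scalerA -expr2 sqr_i scaleN1r redotNl (redotC b).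
  by lra.
by apply: dot_eq_re; rewrite ?re// -linearZ re.
Qed.

Lemma positive_CS x y :
  redot x (S y) ^+ 2 <= redot x (S x) * redot y (S y).
Proof.
apply: discriminant_le => [|t]; first exact: positive_redot_ge0.
have := positive_redot_ge0 (x + t%:C *: y).
rewrite linearD linearZ/= !redotDl !redotDr !redotZl !redotZr.
have -> : redot y (S x) = redot x (S y).
  by rewrite redotC /redot positive_symmetric.
congr (_ <= _); ring.
Qed.

(** Cauchy-Schwarz for the form of [S] at [t] and [S t] gives [q ^+ 2 <= s * r]. Boundedness gives
    [r <= (1 + K) * q], where [1 + K] dominates the square root of [K], and a factor [q] cancels. *)
Lemma positive_sqnorm_le : exists2 k, 0 < k &
  forall t, sqnorm (S t) <= k * redot t (S t).
Proof.
have [K K0 hK] := bS; exists (1 + K) => [|t]; first by lra.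
set q := sqnorm (S t); set s := redot t (S t).
have s0 : 0 <= s by exact: positive_redot_ge0.
have q0 : 0 <= q by exact: sqnorm_ge0.
set r := redot (S t) (S (S t)).
have h1 : q ^+ 2 <= s * r.
  have := positive_CS t (S t).
  by rewrite -/s -/r {1}/redot -positive_symmetric.
have h2 : r ^+ 2 <= K * q ^+ 2.
  apply: (le_trans (redot_CS _ _)); rewrite -/q.
  by have := hK (S t); rewrite -/q; nra.
have h3 : r <= (1 + K) * q.
  rewrite leNgt; apply/negP => h.
  have : 0 < (r - (1 + K) * q) * (r + (1 + K) * q).
    by apply: mulr_gt0; nra.
  have : 0 <= (1 + K + K ^+ 2) * q ^+ 2 by apply: mulr_ge0; nra.
  lra.
rewrite leNgt; apply/negP => h.
have qgt0 : 0 < q by apply: le_lt_trans h; nra.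
have : 0 < q * (q - (1 + K) * s) by rewrite mulr_gt0// subr_gt0.
nra.
Qed.

End PositiveOperator.

Lemma op_inv_eq (T : set (H * H)) (S : H -> H) :
  (forall x y, T (x, y) <-> x = S y) -> op_inv T =1 S.
Proof.
move=> hS y; rewrite /op_inv; case: xgetP => [_ -> /hS//|no].
by case: (no (S y)); apply/hS.
Qed.

(** * Inverting the sum of squares and bounding its inverse *)

Section SumOfSquares.
Variables (T : set (H * H)) (C D S : {linear H -> H}).
Hypothesis lT : linear_relation T.
Hypothesis cT : sqnorm_closed T.
Hypothesis bC : sqnorm_bounded C.
Hypothesis adjC : forall x y, dot (C x) y = dot x (D y).
Hypothesis bS : sqnorm_bounded S.
Hypothesis posS : forall y, 0 <= dot y (S y).
Hypothesis hS : forall x v, T (x, v) -> x = S (D v).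
Hypothesis denseT : forall w, (forall x v, T (x, v) -> dot x w = 0) -> w = 0.

Let N := op_add (sqr_abs dot T) (sqr_abs dot (op_graph C)).

(** The weak form of the equation, which [riesz_energy] solves: moving [D (C x)] to the right leaves
    the condition that [(v, y - D (C x))] is in the adjoint of [T]. *)
Lemma sum_of_squaresP x y : N (x, y) <-> exists2 v, T (x, v) &
  forall x' v', T (x', v') -> dot v' v + dot (C x') (C x) = dot x' y.
Proof.
rewrite /N /op_add /sqr_abs (op_adj_graph adjC) /op_mul /op_graph/=; split.
  move=> [y1 [z [[v Tv hv] [_ -> ->] ->]]]; exists v => // x' v' T'.
  by rewrite (hv _ _ T') adjC linearDr.
move=> [v Tv hv]; exists (y - D (C x)), (D (C x)); split; last by rewrite subrK.
  exists v => // x' v' T' /=.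
  by rewrite linearBr/= -(hv _ _ T') -adjC addrK.
by exists (C x).
Qed.

Lemma redot_pullback_le x v : T (x, v) ->
  redot (D v) (S (D v)) <= energy C x v / 2.
Proof.
move=> /hS <-; rewrite redotC /redot -adjC -/(redot _ _) /energy.
have := sqnorm_ge0 (C x - v); rewrite sqnormB; lra.
Qed.

Lemma sum_of_squares_coercive : exists2 c, 0 < c &
  forall x v, T (x, v) -> sqnorm x <= c * energy C x v.
Proof.
have [k k0 hk] := positive_sqnorm_le bS posS.
exists k => // x v Txv; rewrite {1}(hS Txv).
apply: (le_trans (hk _)); rewrite ler_pM2l//.
have := redot_pullback_le Txv; have := energy_ge0 C x v; lra.
Qed.

Lemma sum_of_squares_energy x v y : (forall x' v', T (x', v') ->
  dot v' v + dot (C x') (C x) = dot x' y) -> T (x, v) ->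
  dot x y = (energy C x v)%:C.
Proof. by move=> h /h <-; rewrite !dotE rmorphD. Qed.

Lemma sum_of_squares_operator : is_operator N.
Proof.
have linN a x y x' y' : N (x, y) -> N (x', y') -> N (a *: x + x', a *: y + y').
  move=> /sum_of_squaresP[v Tv hv] /sum_of_squaresP[v' Tv' hv'].
  apply/sum_of_squaresP; exists (a *: v + v'); first by apply lT.2.
  move=> z w Tzw; rewrite linearP !linearDr !linearZr_LR/= -(hv _ _ Tzw).
  by rewrite -(hv' _ _ Tzw); ring.
split=> //.
  apply/sum_of_squaresP; exists 0; first exact: lT.1.
  by move=> x' v' _; rewrite (linear0 C) !linear0r addr0.
(* The pair [(0, y - y')] has zero energy, so its [v] is 0 and the weak form makes [y - y']
   orthogonal to the domain of [T]. *)
move=> x y y' Ny Ny'; apply/eqP; rewrite -subr_eq0; apply/eqP.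
have := linN (-1) _ _ _ _ Ny' Ny.
rewrite !scaleN1r addNr addrC => /sum_of_squaresP[v Tv hv].
apply: denseT => z w Tzw; rewrite -(hv z w Tzw) (linear0 C) linear0r addr0.
suff -> : v = 0 by rewrite linear0r.
apply: sqnorm_eq0; have := sum_of_squares_energy hv Tv.
rewrite dot0l => -[]; rewrite /energy; have := sqnorm_ge0 (C 0); lra.
Qed.

(** Coercivity reads [sqnorm x <= c * redot x y] on solutions. Cauchy-Schwarz turns this into
    [bound], which yields uniqueness, and thereby linearity of the solution map, as well as its
    boundedness. *)
Lemma sum_of_squares_invertible : invertible_op N.
Proof.
split; first exact: sum_of_squares_operator.
have [c c0 hc] := sum_of_squares_coercive.
have bound x y : N (x, y) -> sqnorm x <= c ^+ 2 * sqnorm y.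
  move=> /sum_of_squaresP[v Tv /sum_of_squares_energy/(_ Tv) e].
  have := hc _ _ Tv; have -> : energy C x v = redot x y by rewrite /redot e.
  have := redot_CS x y; have := sqnorm_ge0 x; have := sqnorm_ge0 y.
  set s := sqnorm x; set r := redot x y; set u := sqnorm y => u0 s0 rsu src.
  have [->|sn0] := eqVneq s 0; first by rewrite mulr_ge0 ?sqr_ge0.
  have sgt0 : 0 < s by rewrite lt0r sn0.
  rewrite -(ler_pM2l sgt0); apply: (@le_trans _ _ ((c * r) ^+ 2)).
    by rewrite -expr2 ler_pXn2r// nnegrE// (le_trans s0).
  by rewrite exprMn [s * _]mulrCA ler_pM2l ?exprn_gt0.
have /choice[f hf] : forall y, exists x, N (x, y).
  move=> y; have [[x v] Txv h] := riesz_energy lT cT bC c0 hc y.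
  exists x; apply/sum_of_squaresP; exists v => // x' v' T'.
  exact: (h (x', v')).
have uniq x x' y : N (x, y) -> N (x', y) -> x = x'.
  move=> h h'; have [_ /(_ (-1)) lin _] := sum_of_squares_operator.
  have := bound _ _ (lin _ _ _ _ h' h).
  rewrite !scaleN1r addNr {2}/sqnorm /redot dot0l mulr0 addrC.
  by move=> /sqnorm_eq0/eqP; rewrite subr_eq0 => /eqP.
have lf : linear f.
  move=> a u v; apply: (uniq _ _ _ (hf _)).
  by have [_ lin _] := sum_of_squares_operator; exact: lin.
exists (linear_map lf).
  apply/bounded_operatorP; exists (c ^+ 2); first by rewrite exprn_gt0.
  by move=> y; exact: bound.
by move=> x y; split=> [h|->]; [exact: uniq h (hf y)|exact: hf].
Qed.

Lemma sum_of_squares_inv_le y : dot (op_inv N y) y <= dot (S y) y.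
Proof.
have [_ [F _ hF]] := sum_of_squares_invertible.
rewrite (op_inv_eq hF); have : N (F y, y) by apply/hF.
set x := F y; move=> /sum_of_squaresP[v Tv /sum_of_squares_energy/(_ Tv) e].
have Sy0 := positive_redot_ge0 posS y.
have -> : dot (S y) y = (redot y (S y))%:C.
  by rewrite positive_symmetric// RRe_real// ger0_real.
rewrite e lecR.
have := positive_CS posS y (D v); rewrite -(hS Tv).
have -> : redot y x = energy C x v by rewrite redotC /redot e.
have := redot_pullback_le Tv; rewrite -(hS Tv).
have := energy_ge0 C x v; set E := energy C x v; set s := redot y _.
set r := redot (D v) x => E0 rE h.
(* Here [E ^+ 2 <= s * r] and [r <= E / 2]; with [s < E] they would contradict [s * E < E ^+ 2]. *)
rewrite leNgt; apply/negP => sE.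
have : 0 <= s * (E / 2 - r) by rewrite mulr_ge0 ?subr_ge0.
have : 0 < (E - s) * E by rewrite mulr_gt0 ?subr_gt0 ?(le_lt_trans Sy0).
nra.
Qed.

End SumOfSquares.

End InnerProduct.

Theorem theorem2p25 (R : realType) (H : completeNormedModType R[i])
    (dot : {dot H for Num.conj}) (hdot : induces_norm dot)
    (A : set (H * H)) (hA : is_operator A) (cA : closed A)
    (B : {linear H -> H}) (hB : bounded_operator B) :
  let gB := op_graph B in
  let BA := op_mul gB A in
  let AB := op_mul A gB in
  let N1 := op_add (sqr_abs dot A) (sqr_abs dot (op_adj dot gB)) in
  let N2 := op_add (sqr_abs dot (op_adj dot A)) (sqr_abs dot gB) in
  (positive_op dot BA -> invertible_op BA ->
     invertible_op N1 /\
     forall x : H, dot (op_inv N1 x) x <= dot (op_inv BA x) x) /\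
  (densely_defined AB -> positive_op dot AB -> invertible_op AB ->
     invertible_op N2 /\
     forall x : H, dot (op_inv N2 x) x <= dot (op_inv AB x) x).
Proof.
move=> gB BA AB N1 N2.
have [A0 linA unA] := hA.
have lA : linear_relation A by split=> // a x v x' v'; exact: linA.
have {}cA := closed_sqnorm_closed hdot cA.
have {}hB := (bounded_operatorP hdot B).1 hB.
have [Bs bBs adjB] := adjoint_exists hdot hB.
have adjBs x y : dot (Bs x) y = dot x (B y) by rewrite dotC -adjB -dotC.
split=> [posBA [[_ _ unBA] [S bS hS]]|_ posAB [_ [S bS hS]]].
  have {}bS := (bounded_operatorP hdot S).1 bS.
  have BAS y : BA (S y, y) by apply/hS.
  have posS y : 0 <= dot y (S y) by exact: posBA.
  have SBA x v : A (x, v) -> x = S (B v) by move=> Axv; apply/hS; exists v.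
  (* [S w] is in the domain of [A], so [redot w (S w) = 0] and hence [S w = 0]; then [w] and 0 are
     both values of [BA] at 0. *)
  have denseA w : (forall x v, A (x, v) -> dot x w = 0) -> w = 0.
    move=> hw; have [v Av _] := BAS w.
    have Sw0 : S w = 0.
      have [k _ /(_ w)] := positive_sqnorm_le bS posS.
      rewrite redotC /redot (hw _ _ Av) mulr0; exact: sqnorm_eq0.
    apply: (unBA 0); first by rewrite -Sw0; exact: BAS.
    by exists 0 => //=; rewrite /gB /op_graph/= linear0.
  rewrite /N1 (op_adj_graph adjB); split.
    exact: (sum_of_squares_invertible hdot lA cA bBs adjBs bS posS SBA denseA).
  move=> x; rewrite (op_inv_eq hS).
  exact: (sum_of_squares_inv_le hdot lA cA bBs adjBs bS posS SBA denseA).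
have {}bS := (bounded_operatorP hdot S).1 bS.
have ABS y : A (B (S y), y) by have /hS[z <-] : S y = S y by [].
have posS y : 0 <= dot y (S y) by apply: posAB; apply/hS.
(* Pairing [x] with [y], a value of [A] at [B (S y)], moves [A], then [B], then the symmetric [S]
   across the inner product. *)
have SAB x v : op_adj dot A (x, v) -> x = S (Bs v).
  move=> h; apply: (@dot_ext _ _ dot) => y.
  by rewrite (h _ _ (ABS y)) adjB -(positive_symmetric posS).
(* This density concerns the domain of the adjoint of [A], which now plays the role of [T]. *)
have denseA := op_adj_dense hdot hA cA.
have lA' := op_adj_linear_relation dot A.
have cA' := op_adj_sqnorm_closed (dot := dot) (T := A).
split=> [|x].
  exact: (sum_of_squares_invertible hdot lA' cA' hB adjB bS posS SAB denseA).
rewrite (op_inv_eq hS).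
exact: (sum_of_squares_inv_le hdot lA' cA' hB adjB bS posS SAB denseA).
Qed.
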